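(* Let $X$ be a metric space that is a union of countably many compact subsets, let $A$ be a (unital, complex) Banach algebra and $G$ its group of invertible elements. Let $U_1$ and $U_2$ be open subsets of $X$ with a nonempty contractible intersection. Then for every continuous map $f:U_1\cap U_2\to G$ there exist continuous maps $f_1:U_1\to G$ and $f_2:U_2\to G$ with $f=f_1^{-1}f_2$ on $U_1\cap U_2$.
   Context: A metric space $Y$ is called contractible if there is a continuous map $H:Y\times[0,1]\to Y$ and a point $x_0\in Y$ with $H(x,0)=x$ and $H(x,1)=x_0$ for all $x\in Y$. Products and inverses of $G$-valued maps are pointwise: $f_1^{-1}(x)=f_1(x)^{-1}$. *)

(* Defs.v *)
From HB Require Import structures.
From mathcomp Require Import all_boot all_order all_algebra.
From mathcomp Require Import all_classical all_reals all_analysis.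
From mathcomp Require Import complex.

Set Implicit Arguments.
Unset Strict Implicit.
Unset Printing Implicit Defensive.

Import Order.TTheory GRing.Theory Num.Theory.
Import numFieldNormedType.Exports.

Local Open Scope classical_set_scope.
Local Open Scope ring_scope.

(* The product is carried by this mixin, and the library's ring and algebra
   structures are derived from it below: Hierarchy Builder rejects a join of
   [NormedModule] with the ring hierarchy, since [numDomainType] already lies
   below both.  [`|1| = 1] is not required. *)
HB.mixin Record CompleteNormedModule_isBanachAlgebra (K : numFieldType) A
    & CompleteNormedModule K A := {
  banach_one : A;
  banach_mul : A -> A -> A;
  banach_mulA : associative banach_mul;
  banach_mul1r : left_id banach_one banach_mul;
  banach_mulr1 : right_id banach_one banach_mul;
  banach_mulDl : left_distributive banach_mul +%R;
  banach_mulDr : right_distributive banach_mul +%R;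
  banach_scaleAl : forall (k : K) (x y : A),
    k *: banach_mul x y = banach_mul (k *: x) y;
  banach_scaleAr : forall (k : K) (x y : A),
    k *: banach_mul x y = banach_mul x (k *: y);
  banach_oner_neq0 : banach_one != 0;
  banach_normM : forall x y : A, `|banach_mul x y| <= `|x| * `|y|
}.

#[short(type="banachAlgType")]
HB.structure Definition BanachAlgebra (K : numFieldType) :=
  {A of CompleteNormedModule K A & CompleteNormedModule_isBanachAlgebra K A}.

Section BanachAlgebraInstances.
Context {K : numFieldType} (A : banachAlgType K).

#[export, non_forgetful_inheritance]
HB.instance Definition _ := GRing.Zmodule_isNzRing.Build A
  (@banach_mulA K A) (@banach_mul1r K A) (@banach_mulr1 K A)
  (@banach_mulDl K A) (@banach_mulDr K A) (@banach_oner_neq0 K A).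
#[export, non_forgetful_inheritance]
HB.instance Definition _ :=
  GRing.LSemiModule_isLSemiAlgebra.Build K A (@banach_scaleAl K A).
#[export, non_forgetful_inheritance]
HB.instance Definition _ :=
  GRing.LSemiAlgebra_isSemiAlgebra.Build K A (@banach_scaleAr K A).

Definition banach_unit : {pred A} :=
  fun x => `[< exists y : A, y * x = 1 /\ x * y = 1 >].
Definition banach_inv (x : A) : A :=
  xget x [set y : A | y * x = 1 /\ x * y = 1].

Let banach_invP (x : A) : x \in banach_unit ->
  banach_inv x * x = 1 /\ x * banach_inv x = 1.
Proof. by move=> /asboolP[y xy]; rewrite /banach_inv; case: xgetP => // /(_ y). Qed.

Fact banach_mulVr : {in banach_unit, left_inverse 1 banach_inv *%R}.
Proof. by move=> x /banach_invP[]. Qed.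

Fact banach_mulrV : {in banach_unit, right_inverse 1 banach_inv *%R}.
Proof. by move=> x /banach_invP[]. Qed.

Fact banach_unitP (x y : A) : y * x = 1 /\ x * y = 1 -> x \in banach_unit.
Proof. by move=> xy; apply/asboolP; exists y. Qed.

Fact banach_inv_out : {in [predC banach_unit], banach_inv =1 id}.
Proof.
move=> x /asboolPn Nx; rewrite /banach_inv; case: xgetP => // y _ xy.
by case: Nx; exists y.
Qed.

#[export, non_forgetful_inheritance]
HB.instance Definition _ := GRing.NzRing_hasMulInverse.Build A
  banach_mulVr banach_mulrV banach_unitP banach_inv_out.

End BanachAlgebraInstances.

Definition sigma_compact (X : topologicalType) : Prop :=
  exists2 C : nat -> set X, forall n, compact (C n) & \bigcup_n C n = setT.

(* Contractibility of the subspace [Y] of [X].  The homotopy is represented by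
   a function on the whole of [X * R], of which only the restriction to
   [Y `*` `[0, 1]] is relevant. *)
Definition contractible (R : realType) (X : metricType R) (Y : set X) : Prop :=
  exists (H : X * R -> X) (x0 : X),
    [/\ {within Y `*` `[0, 1], continuous H},
        forall x t, Y x -> 0 <= t <= 1 -> Y (H (x, t)),
        Y x0
      & forall x, Y x -> H (x, 0) = x /\ H (x, 1) = x0].

(* [f] restricts to a continuous map from the subspace [U] of [X] to the group
   of invertible elements of [A], with the topology induced from [A]. *)
Definition continuous_unit_map (R : realType) (X : metricType R)
    (A : banachAlgType R[i]) (U : set X) (f : X -> A) : Prop :=
  {within U, continuous f} /\ (forall x, U x -> f x \is a GRing.unit).

(* Main.v *)
Require Import Defs.
From HB Require Import structures.
From mathcomp Require Import all_boot all_order all_algebra.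
From mathcomp Require Import all_classical all_reals all_analysis.
From mathcomp Require Import complex lra.
Import Order.TTheory GRing.Theory Num.Theory.
Import numFieldNormedType.Exports.

Local Open Scope classical_set_scope.
Local Open Scope ring_scope.

(** Contracting Y = U1 `&` U2 to the point x0 along H makes F (x, t) =
    f (H (x, t)) a homotopy, through invertible values, from f to the constant
    f x0.  Now let the time depend on the point: [exists_cutoff] gives
    l : X -> [0, 1], continuous on Y, which vanishes near every point of
    U1 `\` U2 and equals 1 near every point of U2 `\` U1.  The map
    g x = F (x, l x) is continuous and invertible on Y; it is the constant
    f x0 near U2 `\` U1, hence extends continuously to f2 on U2, and it
    coincides with f near U1 `\` U2, so that g * f^-1 is 1 there and extends
    continuously to f1 on U1.  On Y, f1^-1 * f2 = f * g^-1 * g = f.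
    Continuity of f1 rests on that of the product and of the inverse of a
    Banach algebra ([banach_cvgM] and [banach_cvgV]). *)

(** The function is the distance to the complement of U; a constant replaces
    it when that complement is empty, since the distance is then infinite. *)
Lemma open_positivity_set {R : realType} {X : metricType R} {U : set X} :
  open U -> exists d : X -> R,
    [/\ continuous d, forall x, 0 <= d x & forall x, 0 < d x <-> U x].
Proof.
move=> oU; have [C0|/set0P[c Cc]] := eqVneq (~` U) set0.
  exists (cst 1); split => [|//|x]; first exact: cst_continuous.
  by split=> // _; apply: contrapT => /= Ux; have : (~` U) x := Ux; rewrite C0.
have dfin x : edist_inf (~` U) x \is a fin_num.
  rewrite ge0_fin_numE ?edist_inf_ge0//.
  have : (edist (x, c) \is a fin_num)%E.
    apply/edist_finP; exists (mdist x c + 1) => /=.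
      exact: ltr_wpDl (mdist_ge0 _ _) ltr01.
    by rewrite ballEmdist/= ltrDl.
  rewrite ge0_fin_numE ?edist_ge0//; apply: le_lt_trans.
  by apply: ereal_inf_lbound; exists c.
exists (fine \o edist_inf (~` U)); split=> [x|x|x].
- apply: continuous_comp; first exact: edist_inf_continuous.
  rewrite -[edist_inf _ x]fineK//; exact: fine_cvg.
- by rewrite fine_ge0// edist_inf_ge0.
split=> [dx|Ux].
  by apply: contrapT => Ux; move: dx; rewrite /= edist_inf0// ltxx.
have /nbhs_ballP[r /= r0 rU] : nbhs x U by exact: open_nbhs_nbhs.
rewrite -lte_fin fineK//; apply: (@lt_le_trans _ _ r%:E); first by rewrite lte_fin.
apply: le_ereal_inf_tmp => _ [a Ua <-]; rewrite leNgt; apply/negP.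
by move=> /edist_lt_ball/rU.
Qed.

(** The distances d1 and d2 to the complements of U1 and U2 make the ratio
    d2 / (d1 + d2) a continuous function on the union of U1 and U2, equal to 0
    on U1 `\` U2 and to 1 on U2 `\` U1.  Truncating an affine function of
    the ratio makes these values locally constant. *)
Lemma exists_cutoff {R : realType} {X : metricType R} {U1 U2 : set X} :
  open U1 -> open U2 -> exists l : X -> R,
    [/\ forall x, 0 <= l x <= 1,
        forall x, (U1 `&` U2) x -> {for x, continuous l},
        forall x, (U1 `\` U2) x -> \forall y \near x, l y = 0
      & forall x, (U2 `\` U1) x -> \forall y \near x, l y = 1].
Proof.
move=> /open_positivity_set[d1 [c1 d1_ge0 d1P]].
move=> /open_positivity_set[d2 [c2 d2_ge0 d2P]].
have d0 (d : X -> R) (U : set X) x : (forall x, 0 <= d x) ->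
    (forall x, 0 < d x <-> U x) -> ~ U x -> d x = 0.
  move=> dge dP Ux; apply/eqP; rewrite eq_le dge andbT leNgt.
  by apply/negP => /dP.
(* The slope 3 gives r <= 0 where the ratio is at most 1/3, and r >= 1 where it
   is at least 2/3. *)
pose r x := 3 * (d2 x / (d1 x + d2 x)) - 1.
have near_lt (a b : X -> R) x : continuous a -> continuous b -> a x < b x ->
    \forall y \near x, a y < b y.
  move=> ca cb ab; have cab : continuous (fun y => b y - a y).
    by move=> y; apply: cvgB; [exact: cb|exact: ca].
  have : b x - a x > 0 by rewrite subr_gt0.
  move=> /(cvgr_gt _ (cab x)); apply: filterS => y.
  by rewrite subr_gt0.
exists (fun x => Num.min 1 (Num.max 0 (r x))); split.
- move=> x; rewrite le_min ler01 le_max lexx/=.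
  by rewrite ge_min lexx.
- move=> x [/d1P p1 /d2P p2].
  have s0 : d1 x + d2 x != 0 by rewrite gt_eqF// addr_gt0.
  have cr : {for x, continuous r}.
    apply: cvgB; last exact: cvg_cst.
    apply: cvgM; first exact: cvg_cst.
    apply: cvgM; first exact: c2.
    by apply: cvgV => //; apply: cvgD; [exact: c1|exact: c2].
  apply: (@continuous_min R X (cst 1) (fun x => Num.max 0 (r x)) x).
    exact: cvg_cst.
  by apply: (@continuous_max R X (cst 0) r x) => //; exact: cvg_cst.
- move=> x [/d1P p1 /(d0 _ _ _ d2_ge0 d2P) p2].
  have : \forall y \near x, 2 * d2 y < d1 y.
    apply: (near_lt (fun y => 2 * d2 y)) => //; last by rewrite p2 mulr0.
    by move=> y; apply: cvgM; [exact: cvg_cst|exact: c2].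
  apply: filterS => y h; have s0 : 0 < d1 y + d2 y.
    by rewrite ltr_pwDl// (le_lt_trans _ h)// mulr_ge0.
  have rn : r y <= 0.
    rewrite /r subr_le0 mulrA ler_pdivrMr// mul1r.
    lra.
  by rewrite max_l// min_r.
- move=> x [/d2P p2 /(d0 _ _ _ d1_ge0 d1P) p1].
  have : \forall y \near x, 2 * d1 y < d2 y.
    apply: (near_lt (fun y => 2 * d1 y)) => //; last by rewrite p1 mulr0.
    by move=> y; apply: cvgM; [exact: cvg_cst|exact: c1].
  apply: filterS => y h; have s0 : 0 < d1 y + d2 y.
    by rewrite ltr_wpDl// (le_lt_trans _ h)// mulr_ge0.
  have rn : 1 <= r y.
    rewrite /r lerBrDr mulrA ler_pdivlMr//.
    lra.
  by rewrite min_l// le_max rn orbT.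
Qed.

Lemma banach_cvgM {K : numFieldType} {A : banachAlgType K} {T : Type}
    {F : set_system T} {FF : Filter F} {f g : T -> A} {a b : A} :
  f @ F --> a -> g @ F --> b -> f x * g x @[x --> F] --> a * b.
Proof.
move=> fa gb; apply/cvgrPdist_lt => e e0.
have a0 : 0 < `|a| + 1 by rewrite ltr_wpDl.
have b0 : 0 < `|b| + 1 by rewrite ltr_wpDl.
have b1 : `|b| < `|b| + 1 by rewrite ltrDl.
near=> x.
have -> : a * b - f x * g x = (a - f x) * g x + a * (b - g x).
  by rewrite mulrBl mulrBr addrCA addrAC subrr add0r addrC.
rewrite (splitr e) (le_lt_trans (ler_normD _ _))// ltr_leD//.
  rewrite (le_lt_trans (banach_normM _ _))//.
  rewrite (@le_lt_trans _ _ (`|a - f x| * (`|b| + 1)))//.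
    by rewrite ler_wpM2l//; near: x; apply: cvgr_norm_le gb _ _.
  rewrite -ltr_pdivlMr//; near: x; apply: cvgr_dist_lt fa _ _.
  by rewrite !divr_gt0.
rewrite (le_trans (banach_normM _ _))//.
rewrite (@le_trans _ _ ((`|a| + 1) * `|b - g x|))//.
  by rewrite ler_wpM2r// lerDl.
rewrite mulrC -ler_pdivlMr//; near: x; apply: cvgr_dist_le gb _ _.
by rewrite !divr_gt0.
Unshelve. all: by end_near. Qed.

(** The point is to bound the norm of (f x)^-1 near the limit.  From
    y^-1 = a^-1 + y^-1 * (a - y) * a^-1, once |a - y| |a^-1| <= 1/2 one gets
    |y^-1| <= |a^-1| + |y^-1| / 2; then
    a^-1 - y^-1 = y^-1 * (y - a) * a^-1 is small together with y - a. *)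
Lemma banach_cvgV {K : numFieldType} {A : banachAlgType K} {T : Type}
    {F : set_system T} {FF : Filter F} {f : T -> A} {a : A} :
  a \is a GRing.unit -> (\forall x \near F, f x \is a GRing.unit) ->
  f @ F --> a -> (f x)^-1 @[x --> F] --> a^-1.
Proof.
move=> ua uf fa; apply/cvgrPdist_lt => e e0.
(* The summand 1 makes c positive, so that it can be divided by. *)
set c := `|a^-1| + 1.
have c0 : 0 < c by rewrite ltr_wpDl.
have ac : `|a^-1| <= c by rewrite lerDl.
near=> x.
have ux : f x \is a GRing.unit by near: x.
have yle : `|(f x)^-1| <= c *+ 2.
  have E : (f x)^-1 = a^-1 + (f x)^-1 * (a - f x) * a^-1.
    by rewrite mulrBr mulVr// mulrBl mulrK// mul1r addrC subrK.
  have h : `|(f x)^-1 * (a - f x) * a^-1| <= `|(f x)^-1| / 2.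
    rewrite -mulrA (le_trans (banach_normM _ _))// ler_wpM2l//.
    rewrite (le_trans (banach_normM _ _))//.
    rewrite (@le_trans _ _ (`|a - f x| * c))// ?ler_wpM2l//.
    rewrite -ler_pdivlMr//; near: x; apply: cvgr_dist_le fa _ _.
    by rewrite divr_gt0 ?invr_gt0.
  rewrite -mulr_natr -ler_pdivrMr// -(@lerD2r _ (`|(f x)^-1| / 2)) -splitr.
  by rewrite {1}E (le_trans (ler_normD _ _))// lerD.
have -> : a^-1 - (f x)^-1 = (f x)^-1 * (f x - a) * a^-1.
  by rewrite mulrBr mulVr// mulrBl mulrK// mul1r.
rewrite (le_lt_trans (banach_normM _ _))//.
rewrite (@le_lt_trans _ _ (`|a - f x| * (c *+ 2) * c))//.
  apply: ler_pM => //; rewrite (le_trans (banach_normM _ _))// mulrC distrC.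
  by rewrite ler_wpM2l.
rewrite -mulrA -ltr_pdivlMr ?mulr_gt0 ?pmulrn_lgt0//.
near: x; apply: cvgr_dist_lt fa _ _.
by rewrite divr_gt0 ?mulr_gt0 ?pmulrn_lgt0.
Unshelve. all: by end_near. Qed.

Lemma continuous_unit_mapP {R : realType} {X : metricType R}
    {A : banachAlgType R[i]} {U : set X} (f : X -> A) : open U ->
  continuous_unit_map U f <->
  (forall x, U x -> {for x, continuous f} /\ f x \is a GRing.unit).
Proof.
move=> oU; rewrite /continuous_unit_map continuous_open_subspace//; split.
  by move=> [cf uf] x Ux; split; [apply: cf; rewrite inE|exact: uf].
by move=> h; split=> [x|x /h[]//]; rewrite inE => /h[].
Qed.

Lemma near_cst_continuous {X Y : topologicalType} {f : X -> Y} (c : Y) {x : X} :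
  (\forall y \near x, f y = c) -> {for x, continuous f}.
Proof.
move=> h; have fx : f x = c by exact: nbhs_singleton h.
by rewrite /prop_for /continuous_at fx; exact: cvg_near_cst.
Qed.

Theorem mainTheorem4 (R : realType) (X : metricType R) (A : banachAlgType R[i])
    (hX : sigma_compact X) (U1 U2 : set X) (oU1 : open U1) (oU2 : open U2)
    (U12_neq0 : U1 `&` U2 !=set0) (U12_contr : contractible (U1 `&` U2))
    (f : X -> A) (hf : continuous_unit_map (U1 `&` U2) f) :
  exists f1 f2 : X -> A,
    [/\ continuous_unit_map U1 f1,
        continuous_unit_map U2 f2
      & forall x, (U1 `&` U2) x -> f x = (f1 x)^-1 * f2 x].
Proof.
have oY : open (U1 `&` U2) by exact: openI.
have [l [l01 lc l0 l1]] := exists_cutoff oU1 oU2.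
case: U12_contr => H [x0 [cH HY Yx0 Hend]].
move: hf => /(continuous_unit_mapP _ oY) hf.
set Y := U1 `&` U2 in oY lc cH HY Yx0 Hend hf *.
have nearY x : Y x -> \forall y \near x, Y y by move=> Yx; exact: open_nbhs_nbhs.
pose g x := f (H (x, l x)).
have gu x : Y x -> g x \is a GRing.unit.
  by move=> Yx; apply: (hf _ _).2; exact: HY.
have gc x : Y x -> {for x, continuous g}.
  move=> Yx; apply: (@continuous_cvg _ _ _ _ _ (fun y => H (y, l y))).
    by apply: (hf _ _).1; exact: HY.
  (* H is only continuous within Y `*` `[0, 1], where (y, l y) stays for y
     near x because Y is open. *)
  have /subspace_continuousP/(_ (x, l x)) := cH.
  rewrite /= in_itv/= l01 => /(_ (conj Yx isT)).
  apply: (@cvg_comp _ _ _ (fun y => (y, l y)) H) => P /= hP.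
  have hp : (y, l y) @[y --> x] --> (x, l x).
    by apply: (@cvg_pair _ _ _ _ (nbhs x) (nbhs (l x))); [exact: cvg_id|exact: lc].
  have := hp _ hP; apply: filterS2 (nearY _ Yx) => y Yy; apply.
  by split => //=; rewrite in_itv/= l01.
have fX0 : f x0 \is a GRing.unit by exact: (hf _ Yx0).2.
pose f2 x : A := if pselect (Y x) then g x else f x0.
pose f1 x : A := if pselect (Y x) then g x * (f x)^-1 else 1.
have f2Y x : Y x -> f2 x = g x by rewrite /f2; case: pselect.
have f1Y x : Y x -> f1 x = g x * (f x)^-1 by rewrite /f1; case: pselect.
have f2N x : ~ Y x -> f2 x = f x0 by rewrite /f2; case: pselect.
have f1N x : ~ Y x -> f1 x = 1 by rewrite /f1; case: pselect.
exists f1, f2; split.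
- apply/continuous_unit_mapP => // x U1x.
  have [U2x|nU2x] := pselect (U2 x).
    have Yx : Y x by [].
    rewrite f1Y// unitrMl ?unitrV ?gu//; last exact: (hf _ Yx).2.
    split => //; rewrite /prop_for /continuous_at f1Y//.
    apply: cvg_trans (banach_cvgM (gc _ Yx) (banach_cvgV (hf _ Yx).2 _ (hf _ Yx).1)).
      apply: near_eq_cvg; apply: filterS (nearY _ Yx) => y Yy.
      by rewrite f1Y.
    by apply: filterS (nearY _ Yx) => y /hf[].
  split; last by rewrite f1N ?unitr1// => -[].
  apply: (near_cst_continuous (1 : A)).
  apply: filterS (l0 x (conj U1x nU2x)) => y ly0.
  rewrite /f1; case: pselect => // Yy; have [Hy0 _] := Hend _ Yy.
  by rewrite /g ly0 Hy0 mulrV//; exact: (hf _ Yy).2.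
- apply/continuous_unit_mapP => // x U2x.
  have [U1x|nU1x] := pselect (U1 x).
    have Yx : Y x by [].
    rewrite f2Y//; split; last exact: gu.
    rewrite /prop_for /continuous_at f2Y//.
    apply: cvg_trans (gc _ Yx).
    by apply: near_eq_cvg; apply: filterS (nearY _ Yx) => y Yy; rewrite f2Y.
  split; last by rewrite f2N// => -[].
  apply: (near_cst_continuous (f x0)).
  apply: filterS (l1 x (conj U2x nU1x)) => y ly1.
  rewrite /f2; case: pselect => // Yy; have [_ Hy1] := Hend _ Yy.
  by rewrite /g ly1 Hy1.
- move=> x Yx; have [_ fx] := hf _ Yx.
  by rewrite f1Y// f2Y// invrM ?gu ?unitrV// invrK mulrVK// gu.
Qed.
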